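(* Let $\Phi$, $g$, $f=\Phi-g$, $L_{yx}$, $L_{yy}$ satisfy the standing assumptions in the context with $\nu>0$; assume additionally that for some $\mu>0$, $\Phi(\cdot,y)$ is $\mu$-strongly convex for every $y\in\operatorname{dom}g$. Let $(x^*,y^* )$ be a saddle-point of $f$. Let $\alpha>0$, set $$\tilde\theta=\max\left\{\frac{L_{yx}}{\alpha\mu+L_{yx}},\ \frac{\alpha L_{yx}+2L_{yy}}{\nu+\alpha L_{yx}+2L_{yy}}\right\},$$ and let $\theta\in(\tilde\theta,1)\subseteq[0,1)$. Let $((x^k,y^k))_{k\in\mathbb{N}}$ be generated by OGAProx (see context) with, for all $k\in\mathbb{N}$, $$\sigma_k\equiv\sigma=\frac1\nu\,\frac{1-\theta}{\theta},\quad\tau_k\equiv\tau=\frac1\mu\,\frac{1-\theta}{\theta},\quad\theta_k\equiv\theta,$$ and let $\hat{x}_k,\hat{y}_k$ ($k\ge1$) be the ergodic averages defined in the context. Then for every $k\in\mathbb{N}\smallsetminus\{0\}$, $$-\theta^{k-1}\left(\frac{1}{2\tau}\|\hat{x}_k-x^0\|^2+\frac{1}{2\sigma}\|y^*-y^0\|^2\right)\le f(\hat{x}_k,\hat{y}_k)-f(x^*,y^* )\le\theta^{k-1}\left(\frac{1}{2\tau}\|x^*-x^0\|^2+\frac{1}{2\sigma}\|\hat{y}_k-y^0\|^2\right).$$ Consequently, $(f(\hat{x}_k,\hat{y}_k))_{k\ge1}$ converges linearly to $f(x^*,y^* )$ with rate $\mathcal{O}(\theta^k)$, i.e. $|f(\hat{x}_k,\hat{y}_k)-f(x^*,y^*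 )|=\mathcal{O}(\theta^k)$.
   Context: $\mathbb{N}=\{0,1,2,\dots\}$. $\mathcal{H}_1,\mathcal{H}_2$ are real Hilbert spaces; $\Phi:\mathcal{H}_1\times\mathcal{H}_2\to\mathbb{R}\cup\{+\infty\}$ with $\operatorname{dom}\Phi=\{(x,y):\Phi(x,y)<+\infty\}\ne\varnothing$; $g:\mathcal{H}_2\to\mathbb{R}\cup\{+\infty\}$; $f(x,y)=\Phi(x,y)-g(y)$. Set $P=\{u\in\mathcal{H}_1:\exists y\in\mathcal{H}_2,\ (u,y)\in\operatorname{dom}\Phi\}$. Standing assumptions: - $g$ is proper, lower semicontinuous, and convex with modulus $\nu\ge0$, i.e. $g-\frac{\nu}{2}\|\cdot\|^2$ is convex. - For every $y\in\operatorname{dom}g$, $\Phi(\cdot,y):\mathcal{H}_1\to\mathbb{R}\cup\{+\infty\}$ is proper, convex and lower semicontinuous. ($\mu$-strongly convex means $\Phi(\cdot,y)-\frac{\mu}{2}\|\cdot\|^2$ is convex.) - $P$ is closed, and for every $x\in P$, $\operatorname{dom}\Phi(x,\cdot)=\mathcal{H}_2$ and $\Phi(x,\cdot):\mathcal{H}_2\to\mathbb{R}$ is concave and Fréchet differentiable. - There are $L_{yx},L_{yy}\ge0$ such that for all $(x,y),(x',y')\in P\times\operatorname{dom}g$: $\|\nabla_y\Phi(x,y)-\nabla_y\Phi(x',y')\|\le L_{yx}\|x-x'\|+L_{yy}\|y-y'\|$. - $f$ has a saddle-point, i.e. a point $(x^*,y^* )\in\mathcal{H}_1\times\mathcal{H}_2$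 with $f(x^*,y)\le f(x^*,y^* )\le f(x,y^* )$ for all $(x,y)\in\mathcal{H}_1\times\mathcal{H}_2$. Proximity operator: $\operatorname{Prox}_h(x)=\operatorname{argmin}_{y}\left(h(y)+\frac12\|x-y\|^2\right)$ for $h$ proper, convex, lower semicontinuous. OGAProx: given $(x^0,y^0)\in P\times\operatorname{dom}g$, $(x^{-1},y^{-1}):=(x^0,y^0)$, and parameters $\sigma_k,\tau_k>0$, $\theta_k\in(0,1]$, for every $k\in\mathbb{N}$: $$y^{k+1}=\operatorname{Prox}_{\sigma_kg}\big(y^k+\sigma_k[(1+\theta_k)\nabla_y\Phi(x^k,y^k)-\theta_k\nabla_y\Phi(x^{k-1},y^{k-1})]\big),\qquad x^{k+1}=\operatorname{Prox}_{\tau_kf(\cdot,y^{k+1})}(x^k).$$ Ergodic averages: $t_k=\frac{\theta_0}{\theta_0\theta_1\cdots\theta_k}$ for $k\in\mathbb{N}$, and for $k\ge1$, $\hat{x}_k=\frac{1}{\sum_{i=0}^{k-1}t_i}\sum_{j=0}^{k-1}t_jx^{j+1}$, $\hat{y}_k=\frac{1}{\sum_{i=0}^{k-1}t_i}\sum_{j=0}^{k-1}t_jy^{j+1}$. *)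

(* Defs.v *)
From HB Require Import structures.
From mathcomp Require Import all_boot all_order all_algebra.
From mathcomp Require Import all_classical all_reals all_analysis.
Import Order.TTheory GRing.Theory Num.Theory.
Import numFieldNormedType.Exports.

Set Implicit Arguments.
Unset Strict Implicit.
Unset Printing Implicit Defensive.

Local Open Scope classical_set_scope.
Local Open Scope ring_scope.

HB.mixin Record CompleteNormedModule_isHilbert (R : realType) (H : Type)
    of CompleteNormedModule R H := {
  inner : {dot H for (@idfun R)} ;
  inner_norm : forall u : H, `|u| ^+ 2 = inner u u
}.

#[short(type="hilbertType")]
HB.structure Definition Hilbert (R : realType) :=
  {H of CompleteNormedModule R H & CompleteNormedModule_isHilbert R H}.

Section ConvexAnalysis.
Context {R : realType} {H : hilbertType R}.
Implicit Types (h : H -> \bar R) (x y p : H).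

Definition eproper h :=
  (forall x, h x != -oo%E) /\ exists x, (h x < +oo)%E.

Definition edom h : set H := [set x | (h x < +oo)%E].

Definition econvex h := forall x y (t : R), 0 < t < 1 ->
  (h (t *: x + (1 - t) *: y)%R <= t%:E * h x + (1 - t)%:E * h y)%E.

Definition econvex_modulus (m : R) h :=
  econvex (fun x => (h x - (m / 2 * `|x| ^+ 2)%:E)%E).

Definition argmin h : set H := [set p | forall x, (h p <= h x)%E].

(* For h proper, convex and lower semicontinuous this set is a singleton. *)
Definition prox h x : set H :=
  argmin (fun y => (h y + (2^-1 * `|x - y| ^+ 2)%:E)%E).

(* The Riesz representative of the Frechet derivative; 0 is a junk value for
   the functions that have no such representative. *)
Definition gradient (F : H -> R) y : H :=
  xget 0 [set w | forall v, 'd (F : H -> R^o) y v = inner w v].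

End ConvexAnalysis.

Section Minimax.
Context {R : realType} {H1 H2 : hilbertType R}.
Variables (Phi : H1 -> H2 -> \bar R) (g : H2 -> \bar R).

(* (+oo) - (+oo), which is -oo here, occurs only at points outside both
   domP and edom g.  Whatever value it is given, no such point is a saddle
   point, and OGAProx evaluates payoff only at second arguments in edom g. *)
Definition payoff (x : H1) (y : H2) : \bar R := (Phi x y - g y)%E.

Definition domP : set H1 := [set u | exists y, (Phi u y < +oo)%E].

Definition grad_y (x : H1) (y : H2) : H2 := gradient (fun z => fine (Phi x z)) y.

Record standing_assumptions (nu Lyx Lyy : R) : Prop := StandingAssumptions {
  Phi_neq_ninfty : forall x y, Phi x y != -oo%E ;
  Phi_dom_neq0 : exists x y, (Phi x y < +oo)%E ;
  g_proper : eproper g ;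
  g_lsc : lower_semicontinuous g ;
  nu_ge0 : 0 <= nu ;
  g_convex : econvex_modulus nu g ;
  Phi_proper : forall y, edom g y -> eproper (Phi^~ y) ;
  Phi_convex : forall y, edom g y -> econvex (Phi^~ y) ;
  Phi_lsc : forall y, edom g y -> lower_semicontinuous (Phi^~ y) ;
  domP_closed : closed domP ;
  Phi_dom_r : forall x, domP x -> edom (Phi x) = [set: H2] ;
  Phi_concave : forall x, domP x -> econvex (fun y => - Phi x y)%E ;
  Phi_differentiable : forall x, domP x ->
    forall y, differentiable ((fun z => fine (Phi x z)) : H2 -> R^o) y ;
  Lyx_ge0 : 0 <= Lyx ;
  Lyy_ge0 : 0 <= Lyy ;
  grad_y_lipschitz : forall x y x' y',
    domP x -> edom g y -> domP x' -> edom g y' ->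
    `|grad_y x y - grad_y x' y'| <= Lyx * `|x - x'| + Lyy * `|y - y'|
}.

Definition saddle_point (xs : H1) (ys : H2) := forall x y,
  (payoff xs y <= payoff xs ys)%E /\ (payoff xs ys <= payoff x ys)%E.

(* x k.-1 is x 0 when k = 0, which encodes (x^{-1}, y^{-1}) = (x^0, y^0). *)
Definition OGAProx (sigma tau theta : nat -> R) (x : nat -> H1) (y : nat -> H2) :=
  [/\ domP (x 0), edom g (y 0) & forall k,
    prox (fun z => (sigma k)%:E * g z)%E
      (y k + sigma k *: ((1 + theta k) *: grad_y (x k) (y k)
                         - theta k *: grad_y (x k.-1) (y k.-1))) (y k.+1) /\
    prox (fun z => (tau k)%:E * payoff z (y k.+1))%E (x k) (x k.+1)].

End Minimax.

Section Ergodic.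
Context {R : realType} {H : hilbertType R}.

Definition ergodic_weight (theta : nat -> R) (k : nat) : R :=
  theta 0 / \prod_(i < k.+1) theta i.

Definition ergodic (theta : nat -> R) (z : nat -> H) (k : nat) : H :=
  (\sum_(i < k) ergodic_weight theta i)^-1 *:
    \sum_(j < k) ergodic_weight theta j *: z j.+1.

End Ergodic.

(* Main.v *)
(* For (u, v) in dom, the three-point inequalities of both proximal steps and
   the gradient inequality for the concave function Phi(x^(k+1), .) bound the gap
   f(x^(k+1), v) - f(u, y^(k+1)) by E_k - E_(k+1) / theta, where
     E_k = |u - x^k|^2 / (2 tau) + |v - y^k|^2 / (2 sigma)
           + theta B_k - theta <s_k, v - y^k>,
     s_k = grad_y Phi(x^k, y^k) - grad_y Phi(x^(k-1), y^(k-1)),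
     B_k = Lyx |x^k - x^(k-1)|^2 / (2 alpha) + Lyy |y^k - y^(k-1)|^2 / 2.
   The lower bound on theta makes Young's inequality absorb the inner products,
   so E_k >= 0.  Multiplying by theta^(-k), telescoping and applying Jensen's
   inequality gives f(xh_k, v) - f(u, yh_k) <= theta^(k-1) E_0; the two estimates
   are the cases (u, v) = (xs, yh_k) and (xh_k, ys).  For (u, v) = (xs, ys) the
   gaps are nonnegative, so E_k <= E_0 bounds the iterates, and with them the
   constants of the linear rate. *)
Require Import Defs.
From HB Require Import structures.
From mathcomp Require Import all_boot all_order all_algebra.
From mathcomp Require Import all_classical all_reals all_analysis.
From mathcomp Require Import ring lra.
Import Order.TTheory GRing.Theory Num.Theory.
Import numFieldNormedType.Exports.
Local Open Scope classical_set_scope.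
Local Open Scope ring_scope.

(** * Hilbert spaces *)

Section HilbertSpace.
Context {R : realType} {H : hilbertType R}.
Implicit Types (u v w : H) (t : R).

Lemma innerC u v : inner u v = inner v u.
Proof. by rewrite hermC expr0 mul1r. Qed.

Lemma innerDl u v w : inner (u + v) w = inner u w + inner v w.
Proof. exact: linearDl. Qed.

Lemma innerZl t u v : inner (t *: u) v = t * inner u v.
Proof. exact: linearZl. Qed.

Lemma innerDr u v w : inner w (u + v) = inner w u + inner w v.
Proof. exact: linearDr. Qed.

Lemma innerZr t u v : inner u (t *: v) = t * inner u v.
Proof. exact: linearZr. Qed.

Lemma innerNr u v : inner u (- v) = - inner u v.
Proof. exact: linearNr. Qed.

Lemma innerBl u v w : inner (u - v) w = inner u w - inner v w.
Proof. exact: linearBl. Qed.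

Lemma innerBr u v w : inner w (u - v) = inner w u - inner w v.
Proof. exact: linearBr. Qed.

Lemma norm2D u v : `|u + v| ^+ 2 = `|u| ^+ 2 + 2 * inner u v + `|v| ^+ 2.
Proof.
rewrite !inner_norm innerDl !innerDr (innerC v u); ring.
Qed.

Lemma norm2Z t u : `|t *: u| ^+ 2 = t ^+ 2 * `|u| ^+ 2.
Proof. by rewrite normrZ exprMn real_normK // num_real. Qed.

Lemma norm2B u v : `|u - v| ^+ 2 = `|u| ^+ 2 - 2 * inner u v + `|v| ^+ 2.
Proof. by rewrite norm2D normrN innerNr mulrN. Qed.

Lemma norm2_convex t u v :
  `|t *: u + (1 - t) *: v| ^+ 2 =
  t * `|u| ^+ 2 + (1 - t) * `|v| ^+ 2 - t * (1 - t) * `|u - v| ^+ 2.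
Proof. rewrite norm2B norm2D !norm2Z innerZl innerZr; ring. Qed.

(** Cauchy-Schwarz, by expanding the squared norm of [|v| u - |u| v] and dividing by [|u| |v|]. *)
Lemma inner_le_norm u v : inner u v <= `|u| * `|v|.
Proof.
have [->|u0] := eqVneq u 0; first by rewrite linear0l normr0 mul0r.
have [->|v0] := eqVneq v 0; first by rewrite linear0r normr0 mulr0.
have uv0 : 0 < `|u| * `|v| by rewrite mulr_gt0 ?normr_gt0.
have : 0 <= `| `|v| *: u - `|u| *: v| ^+ 2 by rewrite exprn_ge0.
rewrite norm2B !norm2Z innerZl innerZr => h.
rewrite -(ler_pM2l uv0); lra.
Qed.

(* The representative minimizes [J v = |v|^2/2 - l v]: by the parallelogram law
   every minimizing sequence is Cauchy, and perturbing the minimizer along [v]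
   gives [l v = <w, v>]. *)
Lemma riesz_representation (l : {linear H -> R^o}) :
  continuous l -> exists w, forall v, l v = inner w v.
Proof.
move=> cl.
have lD u v : (l (u + v) : R) = (l u : R) + (l v : R) by exact: linearD.
have lZ : forall t v, (l (t *: v) : R) = t * (l v : R) by move=> t v; rewrite linearZ.
have [C C0 lC] : exists2 C : R, 0 < C & forall v, `|l v| <= C * `|v|.
  have /linear_boundedP := continuous_linear_bounded 0 (cl 0).
  move=> [M [_ MP]]; exists (`|M| + 1); first by rewrite ltr_pwDr.
  by apply: MP; rewrite (le_lt_trans (ler_norm M)) // ltrDl.
pose J (v : H) : R := 2^-1 * `|v| ^+ 2 - l v.
have JD u v : J (u + v) = J u + J v + inner u v.
  rewrite /J norm2D lD; by field.
have JZ : forall t v, J (t *: v) = t ^+ 2 * (2^-1 * `|v| ^+ 2) - t * l v.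
  move=> t v; rewrite /J norm2Z lZ; congr (_ - _); ring.
have lbJ v : - (2^-1 * C ^+ 2) <= J v.
  have := lC v; rewrite ler_norml /J => /andP[_ h].
  have := sqr_ge0 (`|v| - C); lra.
have infJ : has_inf (range J).
  by split; [exists (J 0), 0 | exists (- (2^-1 * C ^+ 2)) => _ [v _ <-]].
set m := inf (range J).
have mJ v : m <= J v by apply: ge_inf; [case: infJ | exists v].
have minu n : exists v, J v < m + n.+1%:R^-1.
  have /(inf_adherent) /(_ infJ)[_ [v _ <-] h] : (0 : R) < n.+1%:R^-1 by [].
  by exists v.
pose z n := sval (cid (minu n)).
have zP n : J (z n) < m + n.+1%:R^-1 by rewrite /z; case: cid.
have par u v : `|u - v| ^+ 2 <= 4 * (J u + J v - 2 * m).
  have := mJ (2^-1 *: (u + v)); rewrite /J norm2Z lZ lD norm2B norm2D. lra.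
have cz : cvgn z.
  apply/cauchy_cvgP/cauchy_ballP => e e0; rewrite near_map2.
  (* By [par], the squared distance is at most four times the sum of the two excesses of [J] over
     [m]; hence the eighth. *)
  have e20 : 0 < e ^+ 2 / 8 by rewrite divr_gt0 ?exprn_gt0.
  near=> i j => /=.
  rewrite -ball_normE /= -(ltr_pXn2r (n := 2)) ?nnegrE ?normr_ge0 ?(ltW e0) //.
  apply: le_lt_trans (par _ _) _.
  have : i.+1%:R^-1 < e ^+ 2 / 8.
    by near: i; exact: near_infty_natSinv_lt (PosNum e20).
  have : j.+1%:R^-1 < e ^+ 2 / 8.
    by near: j; exact: near_infty_natSinv_lt (PosNum e20).
  have := zP i; have := zP j.
  move: (_%:R^-1) (_%:R^-1) => di dj; lra.
set w := limn z.
have Jw : J w <= m.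
  have cJ : J (z n) @[n --> \oo] --> J w.
    apply: cvgB; last exact: (continuous_cvg _ (cl w) cz).
    apply: cvgMl_tmp; under eq_fun do rewrite expr2.
    by rewrite expr2; apply: cvgM; exact: cvg_norm.
  rewrite -[leRHS]addr0.
  apply: (ler_cvg_to cJ (cvgD (cvg_cst m) cvg_harmonic)).
  by near=> n; exact/ltW/zP.
exists w => v.
have half t : 0 <= t ^+ 2 * (2^-1 * `|v| ^+ 2) - t * (l v - inner w v).
  have := mJ (w + t *: v); rewrite JD JZ innerZr; lra.
have [->|v0] := eqVneq v 0; first by rewrite linear0 linear0r.
have v20 : 0 < `|v| ^+ 2 by rewrite exprn_gt0 ?normr_gt0.
(* This [t] minimizes the quadratic in [half]; the minimum is [- d^2 / (2 |v|^2)], which forces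
   [d = 0]. *)
have := half ((l v - inner w v) / `|v| ^+ 2).
set d := l v - inner w v => h.
have : d ^+ 2 <= 0.
  have -> : d ^+ 2 = - 2 * `|v| ^+ 2 * ((d / `|v| ^+ 2) ^+ 2 *
      (2^-1 * `|v| ^+ 2) - d / `|v| ^+ 2 * d) by field; rewrite normr_eq0.
  by rewrite -mulrA mulNr oppr_le0 !mulr_ge0 // ltW.
by rewrite le_eqVlt ltNge sqr_ge0 /= orbF sqrf_eq0 subr_eq0 => /eqP.
Unshelve. all: by end_near.
Qed.

End HilbertSpace.

(** * Strong convexity of real-valued functions *)

Section RealConvexity.
Context {R : realType} {H : hilbertType R}.
Implicit Types (u v w p z : H) (t m c : R) (D : set H) (F : H -> R).

(** The expanded form of convexity of [F - m/2 |.|^2]. Since [F] has no value [+oo] to mark the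
    outside of [D], convexity of [D] is a clause of its own. *)
Definition convex_on (D : set H) m (F : H -> R) :=
  forall u v t, D u -> D v -> 0 < t < 1 ->
    D (t *: u + (1 - t) *: v) /\
    F (t *: u + (1 - t) *: v) <=
      t * F u + (1 - t) * F v - m / 2 * (t * (1 - t) * `|u - v| ^+ 2).

(** The objective [F + c |w - .|^2] has modulus [2 c + m], so it grows quadratically away from its
    minimizer: compare [p] with [t z + (1 - t) p], divide by [t] and let [t] tend to 0 from the
    right. *)
Lemma convex_on_prox D m c w p F : 0 <= c -> convex_on D m F -> D p ->
  (forall z, D z -> F p + c * `|w - p| ^+ 2 <= F z + c * `|w - z| ^+ 2) ->
  forall z, D z -> F p + c * `|w - p| ^+ 2 + (c + m / 2) * `|z - p| ^+ 2
                   <= F z + c * `|w - z| ^+ 2.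
Proof.
move=> c0 cF Dp minp z Dz; rewrite -lerBrDl.
set d := F z + _ - _; set q := (_ + _) * _.
have step t : 0 < t < 1 -> q - t * q <= d.
  move=> t01; have [Du Fu] := cF z p t Dz Dp t01.
  have := minp _ Du.
  have -> : w - (t *: z + (1 - t) *: p) = t *: (w - z) + (1 - t) *: (w - p).
    by rewrite !scalerBr addrACA -scalerDl subrKC scale1r opprD.
  rewrite norm2_convex opprB [_ + (p - w)]addrC addrA subrK (distrC p).
  move: t01 => /andP[t0 t1] h.
  rewrite -(ler_pM2l t0) /d /q; lra.
have : (fun t => q - t * q) t @[t --> (0 : R)^'+] --> q - 0 * q.
  apply: cvg_at_right_filter; apply: cvgB; first exact: cvg_cst.
  by apply: cvgMr_tmp; exact: cvg_id.
rewrite mul0r subr0 => /cvgr_to_le; apply.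
by near=> t; apply: step; apply/andP; split.
Unshelve. all: by end_near. Qed.

(** Induction on [n]: the new mean is the convex combination of the old mean and the new point in
    which the old mean has weight [s / (s + a n.+1)]. *)
Lemma jensen D m F (a : nat -> R) (z : nat -> H) n : 0 <= m ->
  convex_on D m F -> (forall i, 0 < a i) -> (forall i, D (z i)) ->
  let s := \sum_(i < n.+1) a i in let b := s^-1 *: \sum_(i < n.+1) a i *: z i in
  D b /\ s * F b <= \sum_(i < n.+1) a i * F (z i).
Proof.
move=> m0 cF a0 Dz /=; elim: n => [|n [Db IH]].
  by rewrite !big_ord1 scalerA mulVf ?gt_eqF // scale1r; split.
rewrite !(big_ord_recr n.+1) /=; set s := \sum_(i < _) a i in Db IH *.
set b := s^-1 *: _ in Db IH *.
have s0 : 0 < s.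
  by rewrite /s big_ord_recr /= ltr_wpDl // sumr_ge0 // => i _; exact: ltW.
have sa0 : 0 < s + a n.+1 by rewrite addr_gt0.
pose t := s / (s + a n.+1).
have t1 : 1 - t = a n.+1 / (s + a n.+1) by rewrite /t; field; rewrite gt_eqF.
have t01 : 0 < t < 1 by rewrite {1}/t divr_gt0 //= -[t < 1]subr_gt0 t1 divr_gt0.
have -> : (s + a n.+1)^-1 *: (\sum_(i < n.+1) a i *: z i + a n.+1 *: z n.+1) =
    t *: b + (1 - t) *: z n.+1.
  rewrite t1 /b /t scalerDr !scalerA; congr (_ *: _ + _ *: _); last exact: mulrC.
  by rewrite mulrAC divff ?gt_eqF // mul1r.
have [? h] := cF b (z n.+1) t Db (Dz n.+1) t01; split=> //.
have h' : F (t *: b + (1 - t) *: z n.+1) <= t * F b + (1 - t) * F (z n.+1).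
  apply: (le_trans h); rewrite gerBl mulr_ge0 ?divr_ge0 // mulr_ge0 ?exprn_ge0 //.
  by case/andP: t01 => ? ?; apply: mulr_ge0; rewrite ?subr_ge0 ltW.
have -> : \sum_(i < n.+1) a i * F (z i) + a n.+1 * F (z n.+1) =
  \sum_(i < n.+1) a i * F (z i) - s * F b +
  (s + a n.+1) * (t * F b + (1 - t) * F (z n.+1)).
  by rewrite t1 /t; field; rewrite gt_eqF.
by rewrite -[leLHS]add0r lerD ?subr_ge0 // ler_pM2l.
Qed.

(* Riesz representation rules out the junk value 0 of [gradient]. *)
Lemma gradient_inner F p z : differentiable (F : H -> R^o) p ->
  'd (F : H -> R^o) p z = inner (gradient F p) z.
Proof.
move=> dF; have := riesz_representation _ (diff_continuous dF).
by move=> /(xgetPex 0) /(_ z).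
Qed.

(** By concavity, the difference quotients at [p] towards [z] with step in []0, 1[] are at least
    [F z - F p]; their limit is the directional derivative. *)
Lemma concave_le_gradient F p z :
  (forall u v t, 0 < t < 1 ->
     t * F u + (1 - t) * F v <= F (t *: u + (1 - t) *: v)) ->
  differentiable (F : H -> R^o) p ->
  F z <= F p + inner (gradient F p) (z - p).
Proof.
move=> cF dF; rewrite -lerBlDl -gradient_inner // -deriveE //.
have := cvg_dnbhs_at_right (@diff_derivable _ _ _ _ _ (z - p) dF).
move/cvgr_to_ge; apply; near=> t => /=.
have t0 : 0 < t by near: t; exact: nbhs_right_gt.
have t1 : t < 1 by near: t; exact: nbhs_right_lt.
rewrite -[_ *: _]/(t^-1 * _) ler_pdivlMl //.
have := cF z p t; rewrite t0 t1 => /(_ isT).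
have -> : t *: z + (1 - t) *: p = t *: (z - p) + p.
  by rewrite scalerBr scalerBl scale1r -addrA (addrC p).
lra.
Unshelve. all: by end_near. Qed.

End RealConvexity.

(** * Extended-valued functions and proximal points *)

Section ExtendedReal.
Context {R : realType} {H : hilbertType R}.
Implicit Types (h : H -> \bar R) (u w z p : H) (m c : R).

Lemma edom_fineK h u : h u != -oo%E -> edom h u -> (fine (h u))%:E = h u.
Proof. by rewrite /edom /=; case: (h u). Qed.

Lemma econvex_modulus_on h m : (forall u, h u != -oo%E) ->
  econvex_modulus m h -> convex_on (edom h) m (fun u => fine (h u)).
Proof.
move=> hNy ch u v t hu hv t01; have := ch u v t t01.
rewrite -(edom_fineK _ _ (hNy u) hu) -(edom_fineK _ _ (hNy v) hv) /=.
have := hNy (t *: u + (1 - t) *: v).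
rewrite /edom /=; case: (h (t *: u + _)) => [r|//|//] _ /=.
rewrite lee_fin norm2_convex => hr; split; [exact: ltry | lra].
Qed.

(** Dividing the objective by [c] moves the step size into the quadratic term. Comparison with a
    point of finite value excludes [h p = +oo]. *)
Lemma prox_le h c w p : (forall u, h u != -oo%E) -> (exists z, edom h z) ->
  0 < c -> prox (fun z => c%:E * h z)%E w p ->
  edom h p /\ forall z, edom h z ->
    fine (h p) + (2 * c)^-1 * `|w - p| ^+ 2 <=
    fine (h z) + (2 * c)^-1 * `|w - z| ^+ 2.
Proof.
move=> hNy [z0 hz0] c0 pp.
have hp : edom h p.
  have := pp z0; have := hNy p.
  rewrite /edom /= -(edom_fineK _ _ (hNy z0) hz0).
  by case: (h p) => [r|//|//] _; [rewrite ltry | rewrite gt0_muley ?lte_fin].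
split=> // z hz; have := pp z.
rewrite -(edom_fineK _ _ (hNy z) hz) -(edom_fineK _ _ (hNy p) hp) /= lee_fin.
have cE (X : R) : c * ((2 * c)^-1 * X) = 2^-1 * X by field; rewrite gt_eqF.
by rewrite -(ler_pM2l c0 (fine (h p) + _)) !mulrDr !cE.
Qed.

Lemma prox_three_points h c m w p : (forall u, h u != -oo%E) ->
  (exists z, edom h z) -> 0 < c -> econvex_modulus m h ->
  prox (fun z => c%:E * h z)%E w p ->
  edom h p /\ forall z, edom h z ->
    fine (h p) + (2 * c)^-1 * `|w - p| ^+ 2
      + ((2 * c)^-1 + m / 2) * `|z - p| ^+ 2 <=
    fine (h z) + (2 * c)^-1 * `|w - z| ^+ 2.
Proof.
move=> hNy h0 c0 ch pp; have [hp minp] := prox_le _ _ _ _ hNy h0 c0 pp.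
split=> //; apply: convex_on_prox (minp) => //.
  by rewrite invr_ge0 mulr_ge0 // ltW.
exact: econvex_modulus_on.
Qed.

End ExtendedReal.

(** * Domains, convexity and proximal inequalities for the saddle function *)

Section SaddleFunction.
Context {R : realType} {H1 H2 : hilbertType R}.
Context (Phi : H1 -> H2 -> \bar R) (g : H2 -> \bar R) (nu Lyx Lyy : R).
Hypothesis SA : standing_assumptions Phi g nu Lyx Lyy.

Lemma edom_Phi y : edom (Phi^~ y) = domP Phi.
Proof.
apply/seteqP; split=> x; first by exists y.
by move=> /(Phi_dom_r SA) /seteqP[_ /(_ y)]; exact.
Qed.

Lemma domP_nonempty : exists x, domP Phi x.
Proof. by case: (Phi_dom_neq0 SA) => x [y xy]; exists x, y. Qed.

Lemma Phi_fineK x y : domP Phi x -> (fine (Phi x y))%:E = Phi x y.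
Proof.
rewrite -(edom_Phi y) => xy.
exact: (edom_fineK (Phi^~ y) x (Phi_neq_ninfty SA x y) xy).
Qed.

Lemma g_neq_ninfty y : g y != -oo%E.
Proof. by case: (g_proper SA). Qed.

Lemma g_fineK y : edom g y -> (fine (g y))%:E = g y.
Proof. exact: (edom_fineK _ _ (g_neq_ninfty y)). Qed.

Lemma payoffE x y : domP Phi x -> edom g y ->
  payoff Phi g x y = (fine (Phi x y) - fine (g y))%:E.
Proof. by move=> Px gy; rewrite /payoff -Phi_fineK // -g_fineK. Qed.

(** If [Phi xs] were identically [+oo], testing with [y0] in [edom g] would fail when [g ys = +oo],
    and testing with [x0] in [domP Phi] would fail when [g ys] is finite. Once [xs] is in the
    domain, [y0] forces [g ys] to be finite. *)
Lemma saddle_point_dom xs ys : saddle_point Phi g xs ys ->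
  domP Phi xs /\ edom g ys.
Proof.
move=> sp; have [y0 gy0] := (g_proper SA).2.
have [x0 Px0] := domP_nonempty.
have Pxs : domP Phi xs.
  apply: contrapT => nPxs.
  have Phiy y : Phi xs y = +oo%E.
    by apply/eqP; rewrite -leye_eq leNgt; apply/negP => Pxy; apply: nPxs; exists y.
  have := (sp xs y0).1; have := (sp x0 ys).2; rewrite /payoff !Phiy.
  rewrite -(Phi_fineK x0) // -(g_fineK y0) //.
  by have := g_neq_ninfty ys; case: (g ys).
split=> //; have := (sp xs y0).1.
rewrite (payoffE _ _ Pxs gy0) /payoff -(Phi_fineK xs ys) // /edom /=.
by have := g_neq_ninfty ys; case: (g ys) => [r _ _||]; first exact: ltry.
Qed.

Lemma convex_Phi mu y : econvex_modulus mu (Phi^~ y) ->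
  convex_on (domP Phi) mu (fun x => fine (Phi x y)).
Proof.
rewrite -(edom_Phi y); apply: econvex_modulus_on => x.
exact: (Phi_neq_ninfty SA).
Qed.

Lemma convex_g : convex_on (edom g) nu (fun y => fine (g y)).
Proof. exact/econvex_modulus_on/(g_convex SA)/g_neq_ninfty. Qed.

Lemma concave_Phi x u v (t : R) : domP Phi x -> 0 < t < 1 ->
  t * fine (Phi x u) + (1 - t) * fine (Phi x v) <=
  fine (Phi x (t *: u + (1 - t) *: v)).
Proof.
move=> Px t01; have := Phi_concave SA Px u v t01.
rewrite -(Phi_fineK x u Px) -(Phi_fineK x v Px) -(Phi_fineK x _ Px) lee_fin /=.
lra.
Qed.

Lemma convex_payoff_r x : domP Phi x ->
  convex_on (edom g) nu (fun y => fine (g y) - fine (Phi x y)).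
Proof.
move=> Px u v t gu gv t01; have [guv h] := convex_g u v t gu gv t01.
by split=> //; have := concave_Phi x u v t Px t01; lra.
Qed.

Lemma Phi_le_grad x y z : domP Phi x ->
  fine (Phi x z) <= fine (Phi x y) + inner (grad_y Phi x y) (z - y).
Proof.
move=> Px; apply: concave_le_gradient; last exact: (Phi_differentiable SA).
by move=> u v t; exact: concave_Phi.
Qed.

(** For [y] in [edom g] the payoff differs from [Phi^~ y] by a finite constant, which cancels from
    the comparison and leaves the domain unchanged. *)
Lemma prox_payoff_three_points mu tau w p y : 0 < tau -> edom g y ->
  econvex_modulus mu (Phi^~ y) ->
  prox (fun z => tau%:E * payoff Phi g z y)%E w p ->
  domP Phi p /\ forall z, domP Phi z ->
    fine (Phi p y) + (2 * tau)^-1 * `|w - p| ^+ 2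
      + ((2 * tau)^-1 + mu / 2) * `|z - p| ^+ 2 <=
    fine (Phi z y) + (2 * tau)^-1 * `|w - z| ^+ 2.
Proof.
move=> tau0 gy cPhi pp.
have payoffNy z : payoff Phi g z y != -oo%E.
  rewrite /payoff -(g_fineK _ gy).
  by have := Phi_neq_ninfty SA z y; case: (Phi z y).
have edom_payoff : edom (payoff Phi g ^~ y) = domP Phi.
  rewrite -(edom_Phi y); apply/seteqP; split=> z; rewrite /edom /payoff /=;
  by rewrite -(g_fineK _ gy); case: (Phi z y) => // r; rewrite !ltry.
have [x0 Px0] := domP_nonempty.
have [|Pp minp] := prox_le (payoff Phi g ^~ y) tau w p payoffNy _ tau0 pp.
  by exists x0; rewrite edom_payoff.
rewrite edom_payoff in Pp minp; split=> //.
apply: convex_on_prox => //; first by rewrite invr_ge0 mulr_ge0 // ltW.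
  exact: convex_Phi.
by move=> z Pz; have := minp z Pz; rewrite !payoffE //=; lra.
Qed.

End SaddleFunction.

(** In the descent estimate [d], [e], [f] are the gradients at steps [k+1], [k], [k-1], with
    [w = y^k], [v = y^(k+1)] and [u] the comparison point. The extrapolated gradient is traded for
    the newest one; the two terms paired with [u] telescope and the last one is left to Young's
    inequality. *)
Lemma inner_extrapolation {R : realType} {H : hilbertType R} (t : R)
    (d e f u v w : H) :
  inner ((1 + t) *: e - t *: f) (w - v) =
  inner ((1 + t) *: e - t *: f) (w - u) + inner d (u - v)
  - inner (d - e) (u - v) + t * inner (e - f) (u - w) - t * inner (e - f) (v - w).
Proof.
have -> : (1 + t) *: e - t *: f = e + t *: (e - f).
  by rewrite scalerDl scale1r scalerBr addrA.
have uw : u - w = - (w - u) by rewrite opprB.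
have vw : v - w = - (w - v) by rewrite opprB.
have uv : u - v = (w - v) - (w - u) by rewrite opprB [RHS]addrC addrA subrK.
rewrite uw vw uv !innerNr !innerBr !innerBl !innerDl !innerZl !innerBl; ring.
Qed.

(** * The energy of OGAProx *)

Section Energy.
Context {R : realType} {H1 H2 : hilbertType R}.
Context (Phi : H1 -> H2 -> \bar R) (g : H2 -> \bar R).
Context (nu Lyx Lyy mu alpha theta : R) (x : nat -> H1) (y : nat -> H2).
Hypothesis SA : standing_assumptions Phi g nu Lyx Lyy.
Hypothesis nu_gt0 : 0 < nu.
Hypothesis mu_gt0 : 0 < mu.
Hypothesis Phi_mu : forall z, edom g z -> econvex_modulus mu (Phi^~ z).
Hypothesis alpha_gt0 : 0 < alpha.
Hypothesis theta_bounds :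
  Num.max (Lyx / (alpha * mu + Lyx))
          ((alpha * Lyx + 2 * Lyy) / (nu + alpha * Lyx + 2 * Lyy)) < theta < 1.
Let sigma := nu^-1 * ((1 - theta) / theta).
Let tau := mu^-1 * ((1 - theta) / theta).
Hypothesis xy_OGAProx : OGAProx Phi g (fun=> sigma) (fun=> tau) (fun=> theta) x y.

Let a := (2 * tau)^-1.
Let b := (2 * sigma)^-1.
Let phi u v := fine (Phi u v).
Let gam v := fine (g v).

Let Lyx0 : 0 <= Lyx. Proof. exact: Lyx_ge0 SA. Qed.
Let Lyy0 : 0 <= Lyy. Proof. exact: Lyy_ge0 SA. Qed.

Lemma theta_gt0 : 0 < theta.
Proof.
case/andP: theta_bounds => + _; apply: le_lt_trans.
by rewrite le_max divr_ge0 // addr_ge0 // ltW // mulr_gt0.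
Qed.

Lemma theta_lt1 : theta < 1. Proof. by case/andP: theta_bounds. Qed.

Let th0 := theta_gt0.
Let omth0 : 0 < 1 - theta. Proof. by rewrite subr_gt0 theta_lt1. Qed.
Let thN0 : theta != 0. Proof. by rewrite gt_eqF. Qed.
Let omthN0 : 1 - theta != 0. Proof. by rewrite gt_eqF. Qed.
Let muN0 : mu != 0. Proof. by rewrite gt_eqF. Qed.
Let nuN0 : nu != 0. Proof. by rewrite gt_eqF. Qed.

Lemma tau_gt0 : 0 < tau.
Proof. by rewrite mulr_gt0 ?invr_gt0 // divr_gt0. Qed.

Lemma sigma_gt0 : 0 < sigma.
Proof. by rewrite mulr_gt0 ?invr_gt0 // divr_gt0. Qed.

Let aE : a = mu * theta / (2 * (1 - theta)).
Proof. by rewrite /a /tau; field; rewrite thN0 omthN0 muN0. Qed.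
Let bE : b = nu * theta / (2 * (1 - theta)).
Proof. by rewrite /b /sigma; field; rewrite thN0 omthN0 nuN0. Qed.

Let a_gt0 : 0 < a. Proof. by rewrite /a invr_gt0 mulr_gt0 // tau_gt0. Qed.
Let b_gt0 : 0 < b. Proof. by rewrite /b invr_gt0 mulr_gt0 // sigma_gt0. Qed.

(* The step sizes are chosen so that strong convexity contracts both squared
   distances by exactly the factor [theta]. *)
Let a_contract : a + mu / 2 = theta^-1 * a.
Proof. by rewrite aE; field; rewrite thN0 omthN0. Qed.
Let b_contract : b + nu / 2 = theta^-1 * b.
Proof. by rewrite bE; field; rewrite thN0 omthN0. Qed.

(** The first entry of the maximum says [Lyx (1 - theta) < alpha mu theta]. *)
Let Lyx_le_a : Lyx / (2 * alpha) <= a.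
Proof.
case/andP: theta_bounds; rewrite gt_max => /andP[+ _] _.
rewrite ltr_pdivrMr ?ltr_wpDr ?mulr_gt0 // => h.
rewrite aE ler_pdivrMr ?mulr_gt0 // mulrAC ler_pdivlMr ?mulr_gt0 //; lra.
Qed.

(** The second entry of the maximum says [(alpha Lyx + 2 Lyy) (1 - theta) < nu theta]. *)
Let L_lt_b : alpha * Lyx / 2 + Lyy < b.
Proof.
case/andP: theta_bounds; rewrite gt_max => /andP[_ +] _.
have aL0 : 0 <= alpha * Lyx by rewrite mulr_ge0 // ltW.
have d0 : 0 < nu + alpha * Lyx + 2 * Lyy.
  by rewrite -addrA ltr_wpDr // addr_ge0 // mulr_ge0.
by rewrite ltr_pdivrMr // bE ltr_pdivlMr ?mulr_gt0 // => h; lra.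
Qed.

Let xy_dom k : domP Phi (x k) /\ edom g (y k).
Proof.
case: xy_OGAProx => Px0 gy0 step; elim: k => [//|k _].
have [py px] := step k.
have gy : edom g (y k.+1).
  apply: (prox_le g sigma _ _ (g_neq_ninfty Phi g nu Lyx Lyy SA) _ sigma_gt0 py).1.
  by exists (y 0%N).
split=> //.
exact: (prox_payoff_three_points Phi g nu Lyx Lyy SA _ _ _ _ _ tau_gt0 gy
          (Phi_mu _ gy) px).1.
Qed.

Let s k := grad_y Phi (x k) (y k) - grad_y Phi (x k.-1) (y k.-1).

Let B k := Lyx / (2 * alpha) * `|x k - x k.-1| ^+ 2
           + Lyy / 2 * `|y k - y k.-1| ^+ 2.

Let c := alpha * Lyx / 2 + Lyy / 2.

Let thc_le_c : theta * c <= c.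
Proof.
rewrite ler_piMl ?(ltW theta_lt1) //.
by rewrite addr_ge0 ?divr_ge0 ?mulr_ge0 // ltW.
Qed.

Let c_lt_b : theta * c < b.
Proof.
apply: le_lt_trans L_lt_b; apply: (le_trans thc_le_c).
by rewrite /c lerD2l ler_pdivrMr // ler_peMr // ler1n.
Qed.

(** Cauchy-Schwarz and the Lipschitz bound, then Young's inequality with weight [alpha] for the [x]
    increment and weight 1 for the [y] increment; [c] collects the coefficients of [|d|^2]. *)
Let inner_s_le k d : inner (s k) d <= B k + c * `|d| ^+ 2.
Proof.
apply: (le_trans (inner_le_norm _ _)).
have [Pk gk] := xy_dom k; have [Pk' gk'] := xy_dom k.-1.
have := grad_y_lipschitz SA Pk gk Pk' gk'; rewrite -/(s k).
move/(ler_wpM2r (normr_ge0 d))/le_trans; apply.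
rewrite /B /c; set X := `|x k - _|; set Y := `|y k - _|; set D := `|d|.
have hX : X * D <= X ^+ 2 / (2 * alpha) + alpha * D ^+ 2 / 2.
  rewrite -subr_ge0.
  have -> : X ^+ 2 / (2 * alpha) + alpha * D ^+ 2 / 2 - X * D =
    (X - alpha * D) ^+ 2 / (2 * alpha) by field; rewrite gt_eqF.
  by rewrite divr_ge0 ?sqr_ge0 // mulr_ge0 // ltW.
have hY : Y * D <= Y ^+ 2 / 2 + D ^+ 2 / 2 by have := sqr_ge0 (Y - D); lra.
have := ler_wpM2l Lyx0 hX; have := ler_wpM2l Lyy0 hY; lra.
Qed.

(* The Lyapunov function: weighted squared distances to [(u, v)], corrected by
   the last extrapolation term and by the Young remainder that dominates it. *)
Definition energy u v k :=
  a * `|u - x k| ^+ 2 + b * `|v - y k| ^+ 2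
  + theta * B k - theta * inner (s k) (v - y k).

(** The convention [0.-1 = 0] makes [s 0] and [B 0] vanish. *)
Lemma energy0 u v :
  energy u v 0 = a * `|u - x 0%N| ^+ 2 + b * `|v - y 0%N| ^+ 2.
Proof.
rewrite /energy /B /s !subrr !normr0 linear0l /=; ring.
Qed.

(** Young's inequality at [d = v - y k] uses up the term [theta * B k]. The remaining coefficient
    [b - theta * c] is positive, so the energy controls both distances. *)
Lemma energy_ge u v k :
  a * `|u - x k| ^+ 2 + (b - theta * c) * `|v - y k| ^+ 2 <= energy u v k.
Proof.
have := ler_wpM2l (ltW th0) (inner_s_le k (v - y k)).
by rewrite /energy; lra.
Qed.

Lemma energy_ge0 u v k : 0 <= energy u v k.
Proof.
apply: le_trans (energy_ge u v k).
by rewrite addr_ge0 ?mulr_ge0 ?exprn_ge0 ?subr_ge0 // ltW.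
Qed.

(** Sum of four inequalities: the proximal steps in [x] and in [y], the gradient inequality at
    [y^(k+1)], and [inner_s_le] for the increment [y^(k+1) - y^k]. *)
Lemma energy_descent u v k : domP Phi u -> edom g v ->
  (phi (x k.+1) v - gam v) - (phi u (y k.+1) - gam (y k.+1)) <=
  energy u v k - theta^-1 * energy u v k.+1.
Proof.
move=> Pu gv; case: xy_OGAProx => _ _ /(_ k)[py px].
have [Pp gq] := xy_dom k.+1.
have [_ /(_ _ Pu) hx] := prox_payoff_three_points Phi g nu Lyx Lyy SA
  _ _ _ _ _ tau_gt0 gq (Phi_mu _ gq) px.
have [_ /(_ _ gv) hy] := prox_three_points g sigma nu _ _
  (g_neq_ninfty Phi g nu Lyx Lyy SA) (ex_intro _ _ gv) sigma_gt0
  (g_convex SA) py.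
have hc := Phi_le_grad Phi g nu Lyx Lyy SA _ (y k.+1) v Pp.
have hs := ler_wpM2l (ltW th0) (inner_s_le k (y k.+1 - y k)).
move: hx hy hc hs; rewrite -/a -/b a_contract b_contract.
have -> : theta^-1 * energy u v k.+1 =
  theta^-1 * a * `|u - x k.+1| ^+ 2 + theta^-1 * b * `|v - y k.+1| ^+ 2
  + B k.+1 - inner (s k.+1) (v - y k.+1) by rewrite /energy; field.
set Q := _ *: grad_y _ _ _ - _.
set q := y k.+1; set p := x k.+1; set G := grad_y Phi p q.
(* Since [2 b sigma = 1], shifting the proximal centre by [sigma *: Q] adds exactly
   [inner Q (y k - z)] and a constant [K], which cancels between [z = q] and [z = v]. *)
have [K bQ] : exists K, forall z, b * `|y k + sigma *: Q - z| ^+ 2 =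
    b * `|y k - z| ^+ 2 + inner Q (y k - z) + K.
  exists (b * `|sigma *: Q| ^+ 2) => z.
  rewrite (addrAC (y k)) (norm2D (y k - z)) innerZr innerC /b.
  by field; rewrite gt_eqF // sigma_gt0.
rewrite (bQ q) (bQ v) /energy.
have -> : inner Q (y k - q) = inner Q (y k - v) + inner G (v - q)
    - inner (s k.+1) (v - q) + theta * inner (s k) (v - y k)
    - theta * inner (s k) (q - y k) by exact: inner_extrapolation.
have -> : B k.+1 = Lyx / (2 * alpha) * `|p - x k| ^+ 2
                  + Lyy / 2 * `|q - y k| ^+ 2 by [].
rewrite (distrC (x k) p) (distrC (x k) u) (distrC (y k) q) (distrC (y k) v).
rewrite -/(phi _ _) -/(phi _ _) -/(phi _ _) -/(gam _) -/(gam _).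
have ha : 0 <= (a - Lyx / (2 * alpha)) * `|p - x k| ^+ 2.
  by rewrite mulr_ge0 ?exprn_ge0 ?subr_ge0.
(* The squared [y] increment pays both for Young's inequality ([theta * c]) and for its share of
   [B k.+1] ([Lyy / 2]); this is why [Lyy] enters [L_lt_b] in full rather than halved as in [c]. *)
have hb : 0 <= (b - theta * c - Lyy / 2) * `|q - y k| ^+ 2.
  rewrite mulr_ge0 ?exprn_ge0 // -addrA -opprD subr_ge0.
  by move: thc_le_c L_lt_b; rewrite {2}/c; lra.
clearbody Q G s.
move: ha hb; move: (B k) (inner Q _) (inner G _) (inner (s k.+1) _).
move: (inner (s k) (v - y k)) (inner (s k) (q - y k)) => *; lra.
Qed.

(** * Telescoping and ergodic averages *)

Lemma ergodic_weightE k : ergodic_weight (fun=> theta) k = theta ^- k.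
Proof.
rewrite /ergodic_weight prodr_const card_ord exprS invfM mulrA divff //.
by rewrite mul1r.
Qed.

(** The weight [theta^-k] turns the factor [theta^-1] of the descent into a telescoping sum. *)
Lemma sum_gap_le u v n : domP Phi u -> edom g v ->
  \sum_(k < n) theta ^- k *
    ((phi (x k.+1) v - gam v) - (phi u (y k.+1) - gam (y k.+1))) <=
  energy u v 0 - theta ^- n * energy u v n.
Proof.
move=> Pu gv; elim: n => [|n IH].
  by rewrite big_ord0 expr0 invr1 mul1r subrr.
rewrite big_ord_recr /=.
have th0n : 0 <= theta ^- n by rewrite invr_ge0 exprn_ge0 // ltW.
have := ler_wpM2l th0n (energy_descent u v n Pu gv).
by rewrite exprS invfM; move: IH; lra.
Qed.

(** Jensen's inequality in each variable bounds [S] times the gap at the averages by the weighted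
    sum of gaps, hence by the initial energy. *)
Lemma ergodic_gap_le u v n : domP Phi u -> edom g v ->
  let xh := ergodic (fun=> theta) x n.+1 in
  let yh := ergodic (fun=> theta) y n.+1 in
  [/\ domP Phi xh, edom g yh &
    (phi xh v - gam v) - (phi u yh - gam yh) <= theta ^+ n * energy u v 0].
Proof.
move=> Pu gv xh yh; pose w := ergodic_weight (fun=> theta).
have w0 k : 0 < w k by rewrite /w ergodic_weightE invr_gt0 exprn_gt0.
have [Pxh hx] := jensen _ _ _ w (fun k => x k.+1) n (ltW mu_gt0)
  (convex_Phi Phi g nu Lyx Lyy SA mu v (Phi_mu _ gv)) w0
  (fun k => (xy_dom k.+1).1).
have [gyh hy] := jensen _ _ _ w (fun k => y k.+1) n (ltW nu_gt0)
  (convex_payoff_r Phi g nu Lyx Lyy SA u Pu) w0 (fun k => (xy_dom k.+1).2).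
split=> //; move: hx hy.
rewrite -[_ *: _]/xh -[_ *: \sum_(i < _) _ *: y _]/yh.
rewrite -/(phi _ _) -/(gam _) -/(phi _ _).
set S := \sum_(i < n.+1) w i; set d := _ - _ - _.
(* Keeping only the last of the weights [0..n] gives the exponent [n], one less than the index
   [n.+1] of the averages. *)
have S_ge : theta ^- n <= S.
  rewrite /S big_ord_recr /= {2}/w ergodic_weightE lerDr sumr_ge0 // => i _.
  exact: ltW.
have thn0 : 0 < theta ^- n by rewrite invr_gt0 exprn_gt0.
have S0 : 0 < S by apply: lt_le_trans S_ge.
move=> hx hy.
have hS : S * d <= energy u v 0.
  apply: (@le_trans _ _ (energy u v 0 - theta ^- n.+1 * energy u v n.+1)).
    apply: le_trans (sum_gap_le u v n.+1 Pu gv).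
    have -> : \sum_(k < n.+1) theta ^- k * (phi (x k.+1) v - gam v
          - (phi u (y k.+1) - gam (y k.+1))) =
        \sum_(k < n.+1) w k * phi (x k.+1) v
        + \sum_(k < n.+1) w k * (gam (y k.+1) - phi u (y k.+1)) - S * gam v.
      rewrite /S mulr_suml -big_split -sumrB /=; apply: eq_bigr => k _.
      rewrite /w ergodic_weightE; ring.
    by rewrite /d; move: hx hy; rewrite /phi /gam; lra.
  by rewrite gerBl mulr_ge0 ?energy_ge0 // invr_ge0 exprn_ge0 // ltW.
rewrite -(ler_pM2l S0) (le_trans hS) // mulrA ler_peMl ?energy_ge0 //.
by rewrite -ler_pdivrMr ?exprn_gt0 // mul1r.
Qed.

Lemma ergodic_norm2_le {H : hilbertType R} (z : nat -> H) (e : H) (M : R) n :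
  (forall k, `|z k - e| ^+ 2 <= M) ->
  `|ergodic (fun=> theta) z n.+1 - e| ^+ 2 <= M.
Proof.
(* Jensen's inequality for the zero function on the ball around [e]. *)
move=> zM; pose D := [set u : H | `|u - e| ^+ 2 <= M].
have cD : convex_on D 0 (fun=> 0).
  move=> u v t Du Dv /andP[t0 t1]; split; last by rewrite !(mulr0, mul0r) subr0 addr0.
  rewrite /D /=.
  have -> : t *: u + (1 - t) *: v - e = t *: (u - e) + (1 - t) *: (v - e).
    by rewrite !scalerBr addrACA -opprD -scalerDl subrKC scale1r.
  have t10 : 0 <= 1 - t by rewrite subr_ge0 ltW.
  have h0 : 0 <= t * (1 - t) * `|u - e - (v - e)| ^+ 2.
    by rewrite !mulr_ge0 ?exprn_ge0 // ltW.
  have := ler_wpM2l (ltW t0) Du; have := ler_wpM2l t10 Dv.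
  rewrite norm2_convex /=; lra.
have w0 k : 0 < ergodic_weight (fun=> theta) k.
  by rewrite ergodic_weightE invr_gt0 exprn_gt0.
by have [] := jensen D 0 _ _ (fun k => z k.+1) n (lexx 0) cD w0 (fun k => zM k.+1).
Qed.

(** * Comparison with the saddle point and the linear rate *)

Context (xs : H1) (ys : H2).
Hypothesis sp : saddle_point Phi g xs ys.

Let Pxs : domP Phi xs.
Proof. exact: (saddle_point_dom Phi g nu Lyx Lyy SA xs ys sp).1. Qed.
Let gys : edom g ys.
Proof. exact: (saddle_point_dom Phi g nu Lyx Lyy SA xs ys sp).2. Qed.

Lemma saddle_le_l v : edom g v -> phi xs v - gam v <= phi xs ys - gam ys.
Proof.
by move=> gv; have := (sp xs v).1; rewrite !(payoffE Phi g nu Lyx Lyy SA).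
Qed.

Lemma saddle_le_r u : domP Phi u -> phi xs ys - gam ys <= phi u ys - gam ys.
Proof.
by move=> Pu; have := (sp u ys).2; rewrite !(payoffE Phi g nu Lyx Lyy SA).
Qed.

(** The gaps against the saddle point are nonnegative, so [theta^-n] times the energy at [n] is at
    most the initial energy; and [theta^-n >= 1]. *)
Lemma energy_saddle_le n : energy xs ys n <= energy xs ys 0.
Proof.
have := sum_gap_le xs ys n Pxs gys.
have : 0 <= \sum_(k < n) theta ^- k * (phi (x k.+1) ys - gam ys
    - (phi xs (y k.+1) - gam (y k.+1))).
  apply: sumr_ge0 => k _; rewrite mulr_ge0 ?invr_ge0 ?exprn_ge0 ?(ltW th0) //.
  rewrite subr_ge0; apply: le_trans (saddle_le_r _ (xy_dom k.+1).1).
  exact: saddle_le_l (xy_dom k.+1).2.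
move=> h0 h1; have := le_trans h0 h1; rewrite subr_ge0; apply: le_trans.
rewrite ler_peMl ?energy_ge0 // invf_ge1 ?exprn_gt0 //.
by rewrite exprn_ile1 // ltW // theta_lt1.
Qed.

Let xh := ergodic (fun=> theta) x.
Let yh := ergodic (fun=> theta) y.
Let d k := (phi (xh k) (yh k) - gam (yh k)) - (phi xs ys - gam ys).

Lemma payoff_ergodicE n : payoff Phi g (xh n.+1) (yh n.+1) =
  (d n.+1 + (phi xs ys - gam ys))%:E.
Proof.
have [Pxh gyh _] := ergodic_gap_le xs ys n Pxs gys.
by rewrite (payoffE Phi g nu Lyx Lyy SA) // /d subrK.
Qed.

(** The comparison point [yh n.+1] may depend on [n] because the ergodic bound holds for each fixed
    pair in the domain. A first application at the saddle point supplies [edom g (yh n.+1)]. *)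
Lemma gap_le n : d n.+1 <= theta ^+ n *
  (a * `|xs - x 0%N| ^+ 2 + b * `|yh n.+1 - y 0%N| ^+ 2).
Proof.
have [_ gyh _] := ergodic_gap_le xs ys n Pxs gys.
have [_ _] := ergodic_gap_le xs (yh n.+1) n Pxs gyh.
rewrite energy0 -/(xh _) -/(yh _).
by have := saddle_le_l (yh n.+1) gyh; rewrite /d; lra.
Qed.

Lemma gap_ge n : - theta ^+ n *
  (a * `|xh n.+1 - x 0%N| ^+ 2 + b * `|ys - y 0%N| ^+ 2) <= d n.+1.
Proof.
have [Pxh _ _] := ergodic_gap_le xs ys n Pxs gys.
have [_ _] := ergodic_gap_le (xh n.+1) ys n Pxh gys.
rewrite energy0 -/(xh _) -/(yh _).
by have := saddle_le_r (xh n.+1) Pxh; rewrite /d; lra.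
Qed.

(** The bounds [gap_le] and [gap_ge] still contain the averages. The energy keeps all iterates in
    balls around [xs] and [ys], averages stay in these balls, and [norm2D_le] recentres them at the
    starting point, giving [Mx] and [My]. *)
Lemma gap_bounded : exists2 M, 0 < M & forall n, `|d n.+1| <= M * theta ^+ n.
Proof.
set E0 := energy xs ys 0.
pose Mx := 2 * (E0 / a) + 2 * `|xs - x 0%N| ^+ 2.
pose My := 2 * (E0 / (b - theta * c)) + 2 * `|ys - y 0%N| ^+ 2.
have bc0 : 0 < b - theta * c by rewrite subr_gt0.
have norm2D_le (H : hilbertType R) (p q r : H) :
    `|p - r| ^+ 2 <= 2 * `|p - q| ^+ 2 + 2 * `|q - r| ^+ 2.
  have := sqr_ge0 `|(p - q) - (q - r)|.
  have -> : p - r = (p - q) + (q - r) by rewrite addrA subrK.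
  by rewrite (norm2B (p - q)) (norm2D (p - q)); lra.
have hx n : `|xh n.+1 - x 0%N| ^+ 2 <= Mx.
  apply: (le_trans (norm2D_le _ _ xs _)); rewrite lerD2r ler_pM2l //.
  apply: ergodic_norm2_le => k; rewrite distrC ler_pdivlMr // mulrC.
  apply: le_trans (energy_saddle_le k); apply: le_trans (energy_ge _ _ _).
  by rewrite lerDl mulr_ge0 ?exprn_ge0 // ltW.
have hy n : `|yh n.+1 - y 0%N| ^+ 2 <= My.
  apply: (le_trans (norm2D_le _ _ ys _)); rewrite lerD2r ler_pM2l //.
  apply: ergodic_norm2_le => k; rewrite distrC ler_pdivlMr // mulrC.
  apply: le_trans (energy_saddle_le k); apply: le_trans (energy_ge _ _ _).
  by rewrite lerDr mulr_ge0 ?exprn_ge0 // ltW.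
have Mx0 : 0 <= Mx by apply: le_trans (hx 0%N); rewrite exprn_ge0.
have My0 : 0 <= My by apply: le_trans (hy 0%N); rewrite exprn_ge0.
pose U := a * `|xs - x 0%N| ^+ 2 + b * My.
pose L := a * Mx + b * `|ys - y 0%N| ^+ 2.
have U0 : 0 <= U by rewrite addr_ge0 ?mulr_ge0 ?exprn_ge0 // ltW.
have L0 : 0 <= L by rewrite addr_ge0 ?mulr_ge0 ?exprn_ge0 // ltW.
(* [U] serves the upper bound and [L] the lower one; the summand 1 makes the constant strictly
   positive. *)
exists (1 + U + L) => [|n]; first by rewrite -addrA ltr_wpDr // addr_ge0.
have thn0 : 0 <= theta ^+ n by rewrite exprn_ge0 // ltW.
rewrite ler_norml; apply/andP; split.
  apply: le_trans (gap_ge n); rewrite mulNr lerN2 [leRHS]mulrC ler_wpM2l //.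
  apply: (@le_trans _ _ L); first by rewrite /L lerD2r ler_pM2l.
  by rewrite -[leLHS]add0r lerD2r addr_ge0.
apply: (le_trans (gap_le n)); rewrite [leRHS]mulrC ler_wpM2l //.
apply: (@le_trans _ _ U); first by rewrite /U lerD2l ler_pM2l.
by rewrite addrAC -[leLHS]add0r lerD2r addr_ge0.
Qed.

End Energy.

Theorem theorem3p7 (R : realType) (H1 H2 : hilbertType R)
    (Phi : H1 -> H2 -> \bar R) (g : H2 -> \bar R)
    (nu Lyx Lyy mu alpha theta : R)
    (xs : H1) (ys : H2) (x : nat -> H1) (y : nat -> H2) :
  standing_assumptions Phi g nu Lyx Lyy ->
  0 < nu ->
  0 < mu ->
  (forall z, edom g z -> econvex_modulus mu (Phi^~ z)) ->
  saddle_point Phi g xs ys ->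
  0 < alpha ->
  Num.max (Lyx / (alpha * mu + Lyx))
          ((alpha * Lyx + 2 * Lyy) / (nu + alpha * Lyx + 2 * Lyy)) < theta < 1 ->
  let sigma := nu^-1 * ((1 - theta) / theta) in
  let tau := mu^-1 * ((1 - theta) / theta) in
  OGAProx Phi g (fun=> sigma) (fun=> tau) (fun=> theta) x y ->
  let f := payoff Phi g in
  let xh := ergodic (fun=> theta) x in
  let yh := ergodic (fun=> theta) y in
  [/\ forall k : nat, (0 < k)%N ->
        ((- theta ^+ k.-1 * ((2 * tau)^-1 * `|xh k - x 0%N| ^+ 2
                             + (2 * sigma)^-1 * `|ys - y 0%N| ^+ 2))%:E
           <= f (xh k) (yh k) - f xs ys)%E /\
        (f (xh k) (yh k) - f xs ys
           <= (theta ^+ k.-1 * ((2 * tau)^-1 * `|xs - x 0%N| ^+ 2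
                                + (2 * sigma)^-1 * `|yh k - y 0%N| ^+ 2))%:E)%E,
      f (xh k) (yh k) @[k --> \oo] --> f xs ys
    & ((fun k => fine (f (xh k) (yh k) - f xs ys)%E) : nat -> R^o)
        =O_\oo ((fun k => theta ^+ k) : nat -> R^o) ].
Proof.
move=> SA nu0 mu0 Phi_mu sp alpha0 th sigma tau OGA f xh yh.
have th0 := theta_gt0 _ _ _ _ _ _ _ _ SA mu0 alpha0 th.
have th1 := theta_lt1 _ _ _ _ _ _ th.
have fE := payoff_ergodicE _ _ _ _ _ _ _ _ _ _ SA nu0 mu0 Phi_mu alpha0 th OGA _ _ sp.
have [M M0 gapM] := gap_bounded _ _ _ _ _ _ _ _ _ _ SA nu0 mu0 Phi_mu alpha0 th OGA _ _ sp.
have gapU := gap_le _ _ _ _ _ _ _ _ _ _ SA nu0 mu0 Phi_mu alpha0 th OGA _ _ sp.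
have gapL := gap_ge _ _ _ _ _ _ _ _ _ _ SA nu0 mu0 Phi_mu alpha0 th OGA _ _ sp.
set fs := fine (Phi xs ys) - fine (g ys) in fE gapM gapU gapL.
pose d k := fine (Phi (xh k) (yh k)) - fine (g (yh k)) - fs.
have fsE : f xs ys = fs%:E.
  have [Pxs gys] := saddle_point_dom _ _ _ _ _ SA _ _ sp.
  exact: payoffE SA _ _ Pxs gys.
have fdE n : f (xh n.+1) (yh n.+1) = (d n.+1 + fs)%:E by exact: fE.
have gapE n : (f (xh n.+1) (yh n.+1) - f xs ys)%E = (d n.+1)%:E.
  by rewrite fdE fsE -EFinB addrK.
split.
- by case=> // n _; rewrite gapE !lee_fin; split; [exact: gapL | exact: gapU].
(* At [k = 0] the average is an empty sum, equal to 0 and possibly outside the domain; the shift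
   removes this term. *)
- rewrite -(cvg_shiftS (fun k => f (xh k) (yh k))) fsE.
  under eq_fun do rewrite fdE.
  apply: cvg_EFin; first exact: nearW.
  rewrite -[fs in X in _ --> X]add0r; apply: cvgD; last exact: cvg_cst.
  have hgeo : geometric M theta @ \oo --> 0.
    by apply: cvg_geometric; rewrite ger0_norm // ltW.
  apply: (squeeze_cvgr (f := \- geometric M theta) _ _ hgeo).
    by near=> n; rewrite -ler_norml; exact: gapM.
  by rewrite -[X in _ --> X]oppr0; exact: cvgN hgeo.
(* The gap at index [n.+1] is bounded by [M * theta ^+ n]; dividing by [theta] compensates for the
   exponent [n.+1] in the claim. *)
- apply/eqO_exP; exists (M / theta); first by rewrite divr_gt0.
  near=> k; have : (0 < k)%N by near: k; exact: nbhs_infty_gt.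
  case: {+}k => // n _; rewrite gapE /= exprS.
  have -> : M / theta * `|theta * theta ^+ n| = M * theta ^+ n.
    rewrite ger0_norm; first by rewrite mulrA divfK // gt_eqF.
    by rewrite mulr_ge0 ?exprn_ge0 // ltW.
  exact: gapM.
Unshelve. all: by end_near.
Qed.
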